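(* Consider a computation DAG with scalar output node $z$, $C^1$ assignments, forward-evaluation values $v^*$, and a $C^1$ output factor $\phi:\mathbb{R}\to(0,\infty)$. Let the downward beliefs $b_\downarrow(v)$ be produced by one upward pass (collapsing all upward messages to Dirac masses at the forward values) followed by one downward belief propagation pass on the delta-lifted factor graph, seeded by $m_{\phi\to z}(z)=\phi(z)$, as described in the context. Let $s(v)=\partial_v\log b_\downarrow(v)\big|_{v^*}$. Then $$s(z)=\frac{\phi'(z^* )}{\phi(z^* )},$$ and for every variable $x$ of the DAG, $$\nabla_x\log b_\downarrow(x)\Big|_{x^*}=\frac{\phi'(z^* )}{\phi(z^* )}\;\nabla_x z\Big|_{x^*}.$$ Equivalently, for $\phi(z)=e^{\alpha z}$ (with $\alpha\in\mathbb{R}$) one has $\nabla_x\log b_\downarrow(x)=\alpha\,\nabla_x z$ at the forward point $x^*$.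
   Context: Computation DAG. A finite directed acyclic graph whose nodes are variables $v$ taking values in Euclidean spaces $\mathbb{R}^{d_v}$. Each non-input node $y$ is assigned by $y=\psi_y(x_1,\dots,x_r)$, where $x_1,\dots,x_r$ are its (distinct) parents and $\psi_y$ is $C^1$ on an open set containing the forward values of the parents. The children $\mathrm{ch}(x)$ of $x$ are the nodes $y$ having $x$ as a parent. There is a designated scalar output node $z\in\mathbb{R}$, which has no children. Fixing values of the input nodes and evaluating all assignments gives the forward value $v^*$ of every node $v$ (the forward point). Total derivative. $\nabla_x z|_{x^*}$ is the gradient at $x^*$ of the function obtained by treating $x$ as a free variable near $x^*$, keeping every node that is not a descendant of $x$ at its forward value, recomputing all descendants of $x$ through their assignments, and reading off $z$. In particular $\nabla_z z=1$. Delta-lifted factor graph. Each assignment $y=\psi_y(x_1,\dots,x_r)$ is replaced by a factor $g_y(y,x_1,\dots,x_r)=\delta(y-\psi_y(x_1,\dots,x_r))$, where $\delta$ is the Dirac delta, and the factor $\phi$ is attached to $z$. Downward pass. Messages are positive functions of one variable defined near the forward point, up to positive multiplicative constants ($\propto$); logarithmic derivatives are unaffected by these constants. The seed message is $m_{\phi\to z}(z)=\phi(z)$. Because of the upward pass, in the downward update for $g_y$ all parents of $y$ other than the target one are clamped at their forward values. The downward belief of a variable $v$ is the product of the messages into $v$ from its downstream factors: $b_\downarrow(z)=\phi(z)$, and for $v\ne z$, $b_\downarrow(v)=\prod_{y\in\mathrm{ch}(v)} m_{g_y\to v}(v)$ (the empty product being $1$). The message from a non-input variable $y$ to its own factor $g_y$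 is $m_{y\to g_y}(y)=b_\downarrow(y)$, and for a parent $x_j$ of $y$, $$m_{g_y\to x_j}(x_j)\propto\int\delta\big(y-\psi_y(x_j,x_{-j}^* )\big)\,m_{y\to g_y}(y)\,dy=m_{y\to g_y}\big(\psi_y(x_j,x_{-j}^* )\big),$$ where $x_{-j}^*$ denotes the forward values of the other parents. *)

(* Defs.v *)
From HB Require Import structures.
From mathcomp Require Import all_boot all_order all_algebra.
From mathcomp Require Import all_classical all_reals all_analysis.
Import Order.TTheory GRing.Theory Num.Theory.
Import numFieldNormedType.Exports.

Set Implicit Arguments.
Unset Strict Implicit.
Unset Printing Implicit Defensive.

Local Open Scope classical_set_scope.
Local Open Scope ring_scope.

(** The gradient with respect to the standard coordinates of [R^n].  The
    directional derivative ['D_v f a] is a total operator, so an equation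
    between gradients is to be read together with [differentiable]. *)
Definition grad (R : realType) n (f : 'rV[R]_n -> R) (a : 'rV[R]_n) : 'rV[R]_n :=
  \row_i 'D_(delta_mx 0 i) f a.

Definition C1_on (R : realType) n m (U : set 'rV[R]_n)
    (f : 'rV[R]_n -> 'rV[R]_m) : Prop :=
  (forall p, U p -> differentiable f p) /\ {within U, continuous (jacobian f)}.

Definition C1 (R : realType) (f : R -> R) : Prop :=
  (forall t, derivable f t 1) /\ continuous (derive1 f).

(** The parents of [y] are the values of the injective family [parent y]; the
    argument of [assign y] is the concatenation of the values of the parents,
    in that order.  [assign y] is irrelevant when [y] is an input node. *)
Record computation_dag (R : realType) := ComputationDag {
  node : finType;
  input : pred node;
  ndim : node -> nat;
  arity : node -> nat;
  parent : forall y, 'I_(arity y) -> node;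
  assign : forall y,
    'rV[R]_(\sum_(i < arity y) ndim (parent i)) -> 'rV[R]_(ndim y);
  output : node;
  edge : rel node := fun x y => [exists i : 'I_(arity y), parent i == x];
  parent_inj : forall y, injective (@parent y);
  input_arity : forall y, input y -> arity y = 0%N;
  acyclic : forall x y, edge x y -> ~~ connect edge y x;
  ndim_output : ndim output = 1%N;
  output_childless : forall y, ~~ edge output y }.

Arguments input {R} G : rename.
Arguments ndim {R G} : rename.
Arguments arity {R G} : rename.
Arguments parent {R G} y i : rename.
Arguments assign {R G} y _ : rename.
Arguments output {R} G : rename.
Arguments edge {R} G : rename.

Section ComputationDag.
Variables (R : realType) (G : computation_dag R).

Definition valuation := forall v : node G, 'rV[R]_(ndim v).

Definition node_functions := forall v : node G, 'rV[R]_(ndim v) -> R.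

Definition output_val (t : 'rV[R]_(ndim (output G))) : R :=
  t ord0 (cast_ord (esym (ndim_output G)) ord0).

Definition parent_vals (w : valuation) (y : node G) :
    'rV[R]_(\sum_(i < arity y) ndim (parent y i)) :=
  \mxrow_i w (parent y i).

(** Evaluation of the DAG when the nodes in [fixed] keep their [given] value
    and the others are computed by their assignments.  A round recomputes all
    nodes at once, and [#|node G|] rounds suffice by acyclicity: see
    [evaluateE]. *)
Definition eval_round (fixed : pred (node G)) (given w : valuation) :
    valuation :=
  fun v => if fixed v then given v else assign v (parent_vals w v).

Definition evaluate (fixed : pred (node G)) (given : valuation) : valuation :=
  iter #|node G| (eval_round fixed given) given.

Let ancestors (v : node G) : {set node G} :=
  [set u | connect (edge G) u v]%SET.

Let ancestors_parent (v : node G) (i : 'I_(arity v)) :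
  (#|ancestors (parent v i)| < #|ancestors v|)%N.
Proof.
have e : edge G (parent v i) v by apply/existsP; exists i.
apply: proper_card; apply/properP; split.
  apply/fintype.subsetP => u; rewrite !inE => /connect_trans; apply.
  exact: connect1.
by exists v; rewrite !inE ?connect0//; exact: acyclic e.
Qed.

Let eval_stable fixed given k (v : node G) : (#|ancestors v| <= k)%N ->
  iter k.+1 (eval_round fixed given) given v =
  iter k (eval_round fixed given) given v.
Proof.
elim: k v => [v|k IHk v hk].
  by rewrite leqn0 cards_eq0 => /eqP/finset.setP/(_ v); rewrite !inE connect0.
rewrite (iterS k.+1) [in RHS]iterS [LHS]/eval_round [RHS]/eval_round.
case: ifP => // _.
congr (assign v); apply: eq_mxrow => i; apply: IHk.
by rewrite -ltnS; exact: leq_trans (ancestors_parent i) hk.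
Qed.

Lemma evaluateE fixed given (v : node G) :
  evaluate fixed given v =
  if fixed v then given v else assign v (parent_vals (evaluate fixed given) v).
Proof.
rewrite -[RHS]/(iter #|node G|.+1 (eval_round fixed given) given v).
by rewrite eval_stable// max_card.
Qed.

(** The forward point; only the values of [inp] at the input nodes matter. *)
Definition forward (inp : valuation) : valuation := evaluate (input G) inp.

(** The function whose gradient at [forward inp x] is the total derivative of
    the output with respect to [x]: [x] is set to [u], the nodes that are not
    descendants of [x] keep their forward value. *)
Definition output_of (inp : valuation) (x : node G) (u : 'rV[R]_(ndim x)) : R :=
  output_val
    (evaluate [pred v | (v == x) || ~~ connect (edge G) x v]
              (dfwith (forward inp) x u) (output G)).

Definition total_derivative (inp : valuation) (x : node G) : 'rV[R]_(ndim x) :=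
  grad (output_of inp (x := x)) (forward inp x).

Definition C1_assignments (inp : valuation) : Prop :=
  forall y : node G, ~~ input G y ->
  exists U, [/\ open U, U (parent_vals (forward inp) y) & C1_on U (assign y)].

(** [R^n] with the sigma-algebra of all its subsets: a Dirac mass is defined on
    every set, so that any function, including a message of which only the
    germ at the forward point is meaningful, can be integrated against it. *)
Definition all_measurable n : Type :=
  g_sigma_algebraType ([set: set 'rV[R]_n]).
HB.instance Definition _ n := Measurable.on (all_measurable n).

(** The factor [delta (y - psi_y (x_1, ..., x_r)) dy], as a measure in [y]. *)
Definition delta_factor (y : node G)
    (xs : 'rV[R]_(\sum_(i < arity y) ndim (parent y i))) :=
  @dirac _ (all_measurable (ndim y)) (assign y xs) R.

Lemma integral_delta_factor (y : node G) xs (f : 'rV[R]_(ndim y) -> R) :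
  \int[@delta_factor y xs]_t f t = f (assign y xs).
Proof.
rewrite /Rintegral integral_dirac//; first by rewrite diracT mul1e.
by move=> _ B _; exact: sub_gen_smallest.
Qed.

(** The values of the parents of [y] when the [j]-th one is [u] and the other
    ones are clamped at [w]. *)
Definition clamped_parents (w : valuation) (y : node G) (j : 'I_(arity y))
    (u : 'rV[R]_(ndim (parent y j))) :
    'rV[R]_(\sum_(i < arity y) ndim (parent y i)) :=
  \mxrow_i dfwith (T := fun i => 'rV[R]_(ndim (parent y i)))
                  (fun i => w (parent y i)) j u i.

(** [msg y v] is the message from the factor of [y] to its parent [v], and
    [b v] the downward belief of [v], which is also the message from [v] to its
    own factor.  Messages are determined near the forward point and up to a
    positive constant. *)
Definition downward_pass (phi : R -> R) (w : valuation)
    (msg : node G -> node_functions) (b : node_functions) : Prop :=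
  [/\ forall t, b (output G) t = phi (output_val t),
      forall v t, v != output G -> b v t = \prod_(y | edge G v y) msg y v t
    & forall (y : node G) (j : 'I_(arity y)),
        exists2 c : R, 0 < c &
        \forall u \near w (parent y j),
          msg y (parent y j) u =
          c * \int[delta_factor (clamped_parents w u)]_t b y t].

Definition score (b : node_functions) (w : valuation) (v : node G) :
    'rV[R]_(ndim v) :=
  grad (@ln R \o b v) (w v).

End ComputationDag.

(* Main.v *)
Require Import Defs.
From HB Require Import structures.
From mathcomp Require Import all_boot all_order all_algebra.
From mathcomp Require Import all_classical all_reals all_analysis.
Import Order.TTheory GRing.Theory Num.Theory.
Import numFieldNormedType.Exports.
Local Open Scope classical_set_scope.
Local Open Scope ring_scope.

(** Backpropagation is linear algebra once everything is differentiated at the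
    forward point [w].  Two families of differentials meet at each node [v].

    The adjoint of [v] is the differential of [ln (b v)] at [w v], a linear
    form.  Near [w], integrating the belief of a child [y] against the Dirac
    factor composes [b y] with [assign y], the other parents being clamped; the
    logarithm turns the product over the children into a sum and the unknown
    constants into additive ones, which differentiation removes.  Hence, by
    [adjoint_backward], the adjoint of [v != output G] is the sum over the
    edges [v -> y] of the adjoint of [y] composed with the corresponding
    partial differential of [assign y]; at the output it is the seed
    [phi' / phi] ([adjoint_output]).

    The tangent at [v], for a direction [h] at a node [x], is the derivative of
    the value of [v] when [x] moves along [h].  It is [h] at [x], zero at the
    nodes that do not descend from [x], and elsewhere the image of the parents'
    tangents under the differential of [assign v] ([tangent_other]).  At the
    output it is the total derivative ([is_diff_output_of]).

    The two recursions run in opposite directions, and are compared without any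
    induction in [adjoint_tangent]: the sum over all edges [u -> y] of the
    adjoint of [y] applied to the part of its tangent that comes from [u] is
    grouped once by [u] and once by [y].  Grouping by [u] gives all pairings of
    adjoint and tangent except that of the output, which has no child; grouping
    by [y] gives all of them except that of [x], whose parents do not move.  So
    the pairing at [x], which is the derivative of [ln (b x)] along [h], equals
    the pairing at the output, which is [phi' / phi] times the derivative of
    the output.

    Induction along the edges is used only to know that the functions involved
    are differentiable, downwards for the recomputed values
    ([perturbed_differentiable]) and upwards for the beliefs
    ([belief_log_differentiable]). *)

(** * Differentials *)

Section Differentials.
Set Implicit Arguments.
Unset Strict Implicit.
Variable R : realType.

(** Messages are determined only near the forward point, so differentiability
    has to be transported along equality of germs. *)
Lemma near_eq_is_diff (V W : normedModType R) (f g df : V -> W) (x : V) :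
  is_diff x f df -> (\forall y \near x, f y = g y) -> is_diff x g df.
Proof.
move=> fdf fg; have dfx : differentiable f x by exact: ex_diff.
have gE : g \o shift x = cst (g x) + 'd f x +o_ 0 id.
  apply/eqaddoP => e e0.
  have /eqaddoP/(_ e e0) := diff_locally dfx.
  have fg0 : \forall h \near (0 : V), f (h + x) = g (h + x).
    move: fg; rewrite (near_shift 0 x); apply: filterS => h /=.
    by rewrite subr0.
  rewrite (nbhs_singleton fg); apply: filterS2 fg0 => h /= fgh.
  by rewrite !fctE /= fgh.
have dE := @diff_unique _ _ _ g ('d f x) x (diff_continuous dfx) gE.
split; last by rewrite dE diff_val.
by apply/diff_locallyP; rewrite dE; split=> //; exact: diff_continuous.
Qed.

Lemma is_diff_sum (V W : normedModType R) (I : finType) (P : pred I)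
    (f df : I -> V -> W) (x : V) :
  (forall i, P i -> is_diff x (f i) (df i)) ->
  is_diff x (fun u => \sum_(i | P i) f i u) (fun h => \sum_(i | P i) df i h).
Proof.
move=> fdf.
have -> : (fun u => \sum_(i | P i) f i u) = \sum_(i | P i) f i.
  by apply/funext => u; rewrite fct_sumE.
have -> : (fun u => \sum_(i | P i) df i u) = \sum_(i | P i) df i.
  by apply/funext => u; rewrite fct_sumE.
elim/big_ind2 : _ => //; first exact: is_diff_cst.
by move=> f1 df1 f2 df2; exact: is_diffD.
Qed.

(** Expanding the argument over the canonical basis makes [f] a finite sum of
    coordinates times fixed vectors, hence continuous. *)
Lemma is_diff_linear_rV n (W : normedModType R) (f : {linear 'rV[R]_n -> W})
    (x : 'rV[R]_n) : is_diff x f f.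
Proof.
have fE : (fun u : 'rV[R]_n => \sum_i u ord0 i *: f (delta_mx ord0 i)) = f.
  apply/funext => u; rewrite [in RHS](row_sum_delta u) linear_sum.
  by apply: eq_bigr => i _; rewrite linearZ.
have fc : continuous f.
  move=> u; apply: differentiable_continuous; rewrite -fE.
  have fd i : differentiable
      (fun u : 'rV[R]_n => u ord0 i *: f (delta_mx ord0 i)) u.
    by apply: differentiableZl; exact: differentiable_coord.
  by have [] := is_diff_sum (P := predT) (fun i _ => differentiableP (fd i)).
split; first exact: linear_differentiable.
exact: diff_lin.
Qed.

Lemma is_diff_derive1 (f : R -> R) (t : R) : derivable f t 1 ->
  is_diff t f (fun h => derive1 f t * h).
Proof.
move=> df; split; first exact/derivable1_diffP.
by rewrite deriv1E//; apply/funext => h; rewrite mulrC.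
Qed.

Lemma is_diff_ln (t : R) : 0 < t -> is_diff t (@ln R) (fun h => t^-1 * h).
Proof.
move=> t0; have dln := is_derive1_ln t0.
have := @is_diff_derive1 (@ln R) t (@ex_derive _ _ _ _ _ _ _ dln).
by rewrite derive1E (@derive_val _ _ _ _ _ _ _ dln).
Qed.

Lemma ln_prod (I : finType) (P : pred I) (f : I -> R) :
  (forall i, P i -> 0 < f i) ->
  ln (\prod_(i | P i) f i) = \sum_(i | P i) ln (f i).
Proof.
move=> f0.
(* [lnM] asks for positive factors, so positivity joins the induction. *)
suff [] : 0 < \prod_(i | P i) f i /\
          ln (\prod_(i | P i) f i) = \sum_(i | P i) ln (f i) by [].
elim/big_rec2 : _ => [|i s p Pi [p0 <-]]; first by rewrite ln1.
by rewrite mulr_gt0 ?f0// lnM// posrE f0.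
Qed.

End Differentials.

(** * Concatenation of row vectors *)

Section Blocks.
Set Implicit Arguments.
Unset Strict Implicit.
Variables (R : realType) (k : nat) (q : 'I_k -> nat).

(** Composing the differential of an assignment with [insert_block j] gives its
    partial differential with respect to the [j]-th parent. *)
Definition insert_block (j : 'I_k) (u : 'rV[R]_(q j)) : 'rV[R]_(\sum_i q i) :=
  \mxrow_i dfwith (fun i => 0 : 'rV[R]_(q i)) j u i.

Arguments insert_block : clear implicits.

Lemma insert_block_is_linear j : linear (insert_block j).
Proof.
move=> a u v; apply/matrixP => i c; rewrite !mxE.
move: (tagnat.sig1 c) (tagnat.sig2 c) => l c'.
have [jl|jl] := eqVneq j l; last by rewrite !dfwithout// !mxE mulr0 addr0.
by case: l / jl c' => c'; rewrite !dfwithin !mxE.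
Qed.

HB.instance Definition _ j := GRing.isLinear.Build R _ _ _ (insert_block j)
  (@insert_block_is_linear j).

Lemma mxrow_sum_insert_block (B_ : forall i, 'rV[R]_(q i)) :
  \mxrow_i B_ i = \sum_i insert_block i (B_ i).
Proof.
apply/matrixP => i c; rewrite summxE mxE.
rewrite [RHS](bigD1 (tagnat.sig1 c))//= [X in _ = _ + X]big1 ?addr0.
  by rewrite /insert_block mxE dfwithin.
by move=> j jc; rewrite /insert_block mxE dfwithout// mxE.
Qed.

Lemma is_diff_mxrow (V : normedModType R) (f df : forall i, V -> 'rV[R]_(q i))
    (x : V) : (forall i, is_diff x (f i) (df i)) ->
  is_diff x (fun u => \mxrow_i f i u) (fun h => \mxrow_i df i h).
Proof.
move=> fdf.
have mxrowE (g : forall i, V -> 'rV[R]_(q i)) :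
    (fun u => \mxrow_i g i u) = fun u => \sum_i insert_block i (g i u).
  by apply/funext => u; exact: mxrow_sum_insert_block.
rewrite !mxrowE.
apply: is_diff_sum => i _.
apply: (@is_diff_comp _ _ _ _ (f i) (df i) (insert_block i)).
exact: is_diff_linear_rV.
Qed.

End Blocks.
Arguments insert_block {R k q} j u.

(** * Structure of the DAG *)

Section Dag.
Set Implicit Arguments.
Unset Strict Implicit.
Variables (R : realType) (G : computation_dag R).

Lemma edge_parent (y : node G) (j : 'I_(arity y)) : edge G (parent y j) y.
Proof. by apply/existsP; exists j. Qed.

(** The number of ancestors strictly decreases from a node to its parents. *)
Lemma parents_ind (P : node G -> Prop) :
  (forall v, (forall i, P (parent v i)) -> P v) -> forall v, P v.
Proof.
move=> IH v; move: {2}#|_|.+1 (ltnSn #|[pred u | connect (edge G) u v]|) => n.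
elim: n => // n IHn in v *; rewrite ltnS => vn; apply: IH => i; apply: IHn.
apply: leq_trans vn; apply: proper_card; apply/properP; split.
  apply/fintype.subsetP => u; rewrite !inE => /connect_trans; apply.
  exact/connect1/edge_parent.
by exists v; rewrite !inE ?connect0//; exact: acyclic (edge_parent i).
Qed.

(** The number of descendants strictly decreases from a node to its
    children. *)
Lemma children_ind (P : node G -> Prop) :
  (forall v, (forall y, edge G v y -> P y) -> P v) -> forall v, P v.
Proof.
move=> IH v; move: {2}#|_|.+1 (ltnSn #|connect (edge G) v|) => n.
elim: n => // n IHn in v *; rewrite ltnS => vn; apply: IH => y vy; apply: IHn.
apply: leq_trans vn; apply: proper_card; apply/properP; split.
  by apply/fintype.subsetP => u; rewrite !inE; apply/connect_trans/connect1.
by exists v; rewrite !inE ?connect0//; exact: acyclic vy.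
Qed.

(** Acyclicity makes the recursive equations determine the valuation; this
    identifies the evaluation that fixes [x] at its forward value with the
    forward point itself. *)
Lemma evaluate_unique (fixed : pred (node G)) (given w : valuation G) :
  (forall v, w v = if fixed v then given v else assign v (parent_vals w v)) ->
  forall v, evaluate fixed given v = w v.
Proof.
move=> wE; elim/parents_ind => v IH; rewrite evaluateE wE.
by case: ifP => // _; congr (assign v _); exact: eq_mxrow.
Qed.

Lemma forward_assign (inp : valuation G) (v : node G) : ~~ input G v ->
  forward inp v = assign v (parent_vals (forward inp) v).
Proof. by rewrite /forward evaluateE => /negbTE ->. Qed.

Lemma has_parent_not_input (y : node G) (j : 'I_(arity y)) : ~~ input G y.
Proof. by apply/negP => /input_arity yi; case: j => j; rewrite yi. Qed.

(** A nontrivial path to [v] ends with an edge, which makes [v] a node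
    with a parent; so [C1_assignments] covers every assignment that the
    evaluation fixing [x] uses. *)
Lemma strict_descendant_not_input (x v : node G) :
  v != x -> connect (edge G) x v -> ~~ input G v.
Proof.
move=> vx /connectP[p]; case/lastP: p => [_ vE|p y].
  by rewrite vE /= eqxx in vx.
rewrite rcons_path last_rcons => /andP[_ /existsP[i _]] ->.
exact: has_parent_not_input i.
Qed.

Lemma connect_parent (x v : node G) (i : 'I_(arity v)) :
  connect (edge G) x (parent v i) -> connect (edge G) x v.
Proof. by move/connect_trans; apply; exact/connect1/edge_parent. Qed.

Lemma is_diff_output_val (t : 'rV[R]_(ndim (output G))) :
  is_diff t (@output_val R G) (@output_val R G).
Proof.
have lin : linear (@output_val R G) by move=> a u v; rewrite /output_val !mxE.
pose L : {linear _ -> _} := HB.pack (@output_val R G)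
  (GRing.isLinear.Build _ _ _ _ _ lin).
exact: (is_diff_linear_rV L).
Qed.

(** * Tangents: the forward recursion *)

Section Tangent.
Set Implicit Arguments.
Unset Strict Implicit.
Variables (inp : valuation G) (C1_assign : C1_assignments inp) (x : node G).

Let w := forward inp.

Definition perturbed (u : 'rV[R]_(ndim x)) : valuation G :=
  evaluate [pred v | (v == x) || ~~ connect (edge G) x v] (dfwith w x u).

Lemma perturbed_self u : perturbed u x = u.
Proof. by rewrite /perturbed evaluateE inE eqxx dfwithin. Qed.

Lemma perturbed_nondescendant u v : ~~ connect (edge G) x v ->
  perturbed u v = w v.
Proof.
move=> xv; rewrite /perturbed evaluateE inE xv orbT dfwithout//.
by apply: contraNneq xv => ->; exact: connect0.
Qed.

Lemma perturbed_descendant u v : v != x -> connect (edge G) x v ->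
  perturbed u v = assign v (parent_vals (perturbed u) v).
Proof. by move=> vx xv; rewrite /perturbed evaluateE inE (negbTE vx) xv. Qed.

Lemma perturbed_forward v : perturbed (w x) v = w v.
Proof.
apply: evaluate_unique => {}v; case: ifPn => [_|].
  have [->|xv] := eqVneq x v; first by rewrite dfwithin.
  by rewrite dfwithout.
rewrite negb_or negbK => /andP[vx xv].
exact/forward_assign/strict_descendant_not_input/xv.
Qed.

Lemma assign_differentiable v : ~~ input G v ->
  differentiable (@assign R G v) (parent_vals w v).
Proof. by case/C1_assign => U [_ Uw [dU _]]; exact: dU. Qed.

Definition tangent (h : 'rV[R]_(ndim x)) : valuation G :=
  fun v => 'd (perturbed ^~ v) (w x) h.

Lemma is_diff_descendant v : v != x -> connect (edge G) x v ->
  (forall i, differentiable (perturbed ^~ (parent v i)) (w x)) ->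
  is_diff (w x) (perturbed ^~ v)
    (fun h => 'd (@assign R G v) (parent_vals w v) (parent_vals (tangent h) v)).
Proof.
move=> vx xv dp.
have -> : perturbed ^~ v =
    @assign R G v \o (fun u => parent_vals (perturbed u) v).
  by apply/funext => u; rewrite /= -perturbed_descendant.
apply: is_diff_comp.
  by apply: is_diff_mxrow => i; exact: differentiableP.
have -> : parent_vals (perturbed (w x)) v = parent_vals w v.
  by apply: eq_mxrow => i; exact: perturbed_forward.
exact/differentiableP/assign_differentiable/strict_descendant_not_input/xv.
Qed.

Lemma perturbed_differentiable v : differentiable (perturbed ^~ v) (w x).
Proof.
elim/parents_ind: v => v IH.
have [->|vx] := eqVneq v x.
  rewrite (_ : (fun u => _) = id).
    by have [] := is_diff_id (w x).
  by apply/funext => u; exact: perturbed_self.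
have [xv|xv] := boolP (connect (edge G) x v).
  by have [] := is_diff_descendant vx xv IH.
rewrite (_ : (fun u => _) = cst (w v)); first exact: differentiable_cst.
by apply/funext => u; exact: perturbed_nondescendant.
Qed.

Lemma tangent_self h : tangent h x = h.
Proof.
rewrite /tangent (_ : (fun u => _) = id).
  by rewrite (@diff_val _ _ _ _ _ _ _ (is_diff_id _)).
by apply/funext => u; exact: perturbed_self.
Qed.

Lemma tangent_nondescendant h v : ~~ connect (edge G) x v -> tangent h v = 0.
Proof.
move=> xv; rewrite /tangent (_ : (fun u => _) = cst (w v)).
  by rewrite diff_cst.
by apply/funext => u; exact: perturbed_nondescendant.
Qed.

(** The chain rule holds also at nodes that do not descend from [x], where both
    sides vanish; this uniformity is what lets [adjoint_tangent] sum over all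
    nodes. *)
Lemma tangent_other h v : v != x ->
  tangent h v = 'd (@assign R G v) (parent_vals w v) (parent_vals (tangent h) v).
Proof.
move=> vx; have [xv|xv] := boolP (connect (edge G) x v).
  have := is_diff_descendant vx xv (fun i => perturbed_differentiable _).
  by move=> [_ /(congr1 (fun f => f h))].
suff -> : parent_vals (tangent h) v = 0.
  by rewrite tangent_nondescendant// linear0.
rewrite -mxrow0; apply: eq_mxrow => i; apply: tangent_nondescendant.
by apply: contraNN xv; exact: connect_parent.
Qed.

(** By acyclicity no parent of [x] descends from [x], so none of them moves. *)
Lemma parent_vals_tangent_self h : parent_vals (tangent h) x = 0.
Proof.
rewrite -mxrow0; apply: eq_mxrow => i; apply: tangent_nondescendant.
exact: acyclic (edge_parent i).
Qed.

Lemma is_diff_output_of : is_diff (w x) (output_of inp (x := x))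
  (fun h => output_val (tangent h (output G))).
Proof.
apply: (@is_diff_comp _ _ _ _ (perturbed ^~ (output G)) _ (@output_val R G)).
  exact/differentiableP/perturbed_differentiable.
exact: is_diff_output_val.
Qed.

End Tangent.

(** * Adjoints: the backward recursion *)

Section Downward.
Variables (inp : valuation G) (C1_assign : C1_assignments inp).

Let w := forward inp.

Variables (phi : R -> R) (C1_phi : C1 phi) (phi_gt0 : forall t, 0 < phi t).
Variables (msg : node G -> node_functions G) (b : node_functions G).
Hypothesis dp : downward_pass phi w msg b.

Arguments b : clear implicits.
Arguments msg : clear implicits.

Let zstar := output_val (w (output G)).

Definition adjoint (v : node G) (h : 'rV[R]_(ndim v)) : R :=
  'd (@ln R \o b v) (w v) h.

(** Positivity is part of the induction: [ln] of a product splits only where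
    the factors are positive. *)
Definition log_differentiable n (f : 'rV[R]_n -> R) (a : 'rV[R]_n) : Prop :=
  (\forall t \near a, 0 < f t) /\ differentiable (@ln R \o f) a.

Lemma is_diff_ln_belief_output : is_diff (w (output G)) (@ln R \o b (output G))
  (fun h => derive1 phi zstar / phi zstar * output_val h).
Proof.
have [bz _ _] := dp; have -> : b (output G) = phi \o @output_val R G.
  by apply/funext => t; exact: bz.
have dphi : is_diff zstar phi (fun h => derive1 phi zstar * h).
  by apply: is_diff_derive1; exact: C1_phi.1.
have dln := is_diff_ln (phi_gt0 zstar).
have := is_diff_comp (is_diff_comp (is_diff_output_val (w (output G))) dphi) dln.
move=> /is_diff_eq; apply; apply/funext => h /=.
by rewrite mulrA [_^-1 * _]mulrC.
Qed.

Lemma belief_output_log_differentiable :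
  log_differentiable (b (output G)) (w (output G)).
Proof.
split; last by have [] := is_diff_ln_belief_output.
by have [bz _ _] := dp; near=> t; rewrite bz.
Unshelve. all: by end_near. Qed.

Lemma is_diff_clamped_parents (y : node G) (j : 'I_(arity y)) :
  is_diff (w (parent y j)) (clamped_parents w (j := j)) (insert_block j).
Proof.
apply: is_diff_mxrow => i; have [<-|ji] := eqVneq j i.
  rewrite (_ : (fun u => _) = id); last by apply/funext => u; rewrite dfwithin.
  (* the same block of the differential [insert_block j] *)
  rewrite (_ : (fun u => _) = id); last by apply/funext => u; rewrite dfwithin.
  exact: is_diff_id.
rewrite (_ : (fun u => _) = cst (w (parent y i))); last first.
  by apply/funext => u; rewrite dfwithout.
rewrite (_ : (fun u => _) = 0); last by apply/funext => u; rewrite dfwithout.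
exact: is_diff_cst.
Qed.

Lemma clamped_parents_forward (y : node G) (j : 'I_(arity y)) :
  clamped_parents w (w (parent y j)) = parent_vals w y.
Proof.
apply: eq_mxrow => i; have [<-|ji] := eqVneq j i; first by rewrite dfwithin.
by rewrite dfwithout.
Qed.

(** Integrating against the Dirac factor substitutes [assign y]; the constant
    of proportionality becomes an additive one under [ln]. *)
Lemma message_log_differentiable (y : node G) (j : 'I_(arity y)) :
  log_differentiable (b y) (w y) ->
  (\forall u \near w (parent y j), 0 < msg y (parent y j) u) /\
  is_diff (w (parent y j)) (@ln R \o msg y (parent y j))
    (fun h => adjoint ('d (@assign R G y) (parent_vals w y) (insert_block j h))).
Proof.
move=> [b_gt0 db]; have yNi := has_parent_not_input j.
have [_ _ /(_ y j)[c c0 msgE]] := dp.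
pose A u := assign y (clamped_parents w (j := j) u).
have Aw : A (w (parent y j)) = w y.
  by rewrite /A clamped_parents_forward -forward_assign.
have dA : is_diff (w (parent y j)) A
    (fun h => 'd (@assign R G y) (parent_vals w y) (insert_block j h)).
  apply: is_diff_comp; first exact: is_diff_clamped_parents.
  rewrite clamped_parents_forward.
  exact/differentiableP/assign_differentiable.
have bA_gt0 : \forall u \near w (parent y j), 0 < b y (A u).
  have /differentiable_continuous cA : differentiable A (w (parent y j)) by [].
  by move: b_gt0; rewrite -{1}Aw => /cA; rewrite nbhs_simpl.
have {}msgE :
    \forall u \near w (parent y j), msg y (parent y j) u = c * b y (A u).
  by apply: filterS msgE => u ->; rewrite integral_delta_factor.
split; first by apply: filterS2 bA_gt0 msgE => u u0 ->; exact: mulr_gt0.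
have db' : is_diff (A (w (parent y j))) (@ln R \o b y) (@adjoint y).
  by rewrite Aw; exact: differentiableP.
have := is_diffD (is_diff_cst (ln c) (w (parent y j))) (is_diff_comp dA db').
rewrite add0r => /near_eq_is_diff; apply.
by apply: filterS2 bA_gt0 msgE => u u0 /= ->; rewrite lnM.
Qed.

Lemma edge_log_differentiable (v y : node G) : edge G v y ->
  log_differentiable (b y) (w y) -> log_differentiable (msg y v) (w v).
Proof.
move=> /existsP[j /eqP <-] /(message_log_differentiable j)[m0 dm].
by split => //; exact: ex_diff.
Qed.

Lemma is_diff_ln_belief (v : node G) : v != output G ->
  (forall y, edge G v y -> log_differentiable (msg y v) (w v)) ->
  (\forall t \near w v, 0 < b v t) /\
  is_diff (w v) (@ln R \o b v)
    (fun h => \sum_(y | edge G v y) 'd (@ln R \o msg y v) (w v) h).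
Proof.
move=> vz mP; have [_ bE _] := dp.
have m_gt0 : \forall t \near w v, forall y, edge G v y -> 0 < msg y v t.
  apply: (@filter_forall _ _ (fun y t => edge G v y -> 0 < msg y v t)
    (nbhs (w v))) => y.
  have [vy|_] := boolP (edge G v y); last by near=> t.
  by apply: filterS (mP y vy).1.
split.
  by apply: filterS m_gt0 => t m0; rewrite bE// prodr_gt0.
have dm y : edge G v y ->
    is_diff (w v) (@ln R \o msg y v) ('d (@ln R \o msg y v) (w v)).
  by move=> /mP[_]; exact: differentiableP.
have /near_eq_is_diff := is_diff_sum dm; apply.
by apply: filterS m_gt0 => t m0 /=; rewrite bE// ln_prod.
Unshelve. all: by end_near. Qed.

(** Beliefs are built from those of the children, hence induction from the
    leaves up. *)
Lemma belief_log_differentiable (v : node G) : log_differentiable (b v) (w v).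
Proof.
elim/children_ind : v => v IH.
have [->|vz] := eqVneq v (output G); first exact: belief_output_log_differentiable.
have [|b0 db] := @is_diff_ln_belief v vz.
  by move=> y vy; apply: edge_log_differentiable => //; exact: IH.
by split => //; exact: ex_diff.
Qed.

Lemma adjoint_output h :
  adjoint (v := output G) h = derive1 phi zstar / phi zstar * output_val h.
Proof. by rewrite /adjoint (@diff_val _ _ _ _ _ _ _ is_diff_ln_belief_output). Qed.

(** Indexing the edges out of [v] by the pairs [(y, j)] with [parent y j == v],
    and evaluating on a family [tau] of vectors given at all nodes, lets every
    term be stated at [parent y j] and avoids casts along
    [parent y j = v]. *)
Lemma adjoint_backward (tau : valuation G) (v : node G) : v != output G ->
  adjoint (tau v) =
  \sum_y \sum_(j | parent y j == v)
    adjoint ('d (@assign R G y) (parent_vals w y)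
               (insert_block j (tau (parent y j)))).
Proof.
move=> vz; rewrite /adjoint.
have [|_ db] := @is_diff_ln_belief v vz.
  move=> y vy; apply: edge_log_differentiable => //.
  exact: belief_log_differentiable.
rewrite (@diff_val _ _ _ _ _ _ _ db) big_mkcond; apply: eq_bigr => y _.
pose F u := 'd (@ln R \o msg y u) (w u) (tau u).
transitivity (\sum_(j < arity y | parent y j == v) F v); last first.
  apply: eq_bigr => j /eqP <-.
  have [_ dm] := message_log_differentiable j (belief_log_differentiable y).
  by rewrite /F (@diff_val _ _ _ _ _ _ _ dm).
case: ifPn => [/existsP[j /eqP jv]|/existsPn jv]; last first.
  by rewrite big_pred0// => j; exact/negbTE/jv.
(* As parents are distinct, an edge is given by exactly one index [j]. *)
by rewrite (big_pred1 j)// => i; rewrite -jv (inj_eq (@parent_inj _ _ _)).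
Qed.

(** Reverse and forward accumulation agree, by double counting over the
    edges. *)
Lemma adjoint_tangent (x : node G) (h : 'rV[R]_(ndim x)) :
  adjoint h = adjoint (tangent inp h (output G)).
Proof.
pose T := tangent inp h.
pose X y (j : 'I_(arity y)) := adjoint ('d (@assign R G y) (parent_vals w y)
  (insert_block j (T (parent y j)))).
have XE y : \sum_j X y j =
    adjoint ('d (@assign R G y) (parent_vals w y) (parent_vals T y)).
  have -> : parent_vals T y = \sum_i insert_block i (T (parent y i)).
    exact: mxrow_sum_insert_block.
  by rewrite /adjoint !linear_sum.
(* Grouping by source node: the output is the only node with no backward
   equation, and it is the source of no edge. *)
have sumE : \sum_v adjoint (T v) = adjoint (T (output G)) + \sum_y \sum_j X y j.
  rewrite (bigD1 (output G))//=; congr (_ + _).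
  under eq_bigr => v vz do rewrite (adjoint_backward T vz).
  rewrite exchange_big/=; apply: eq_bigr => y _.
  rewrite [RHS](partition_big (parent y) (fun v => v != output G))//= => j _.
  apply/eqP => jz; have := output_childless y; rewrite -jz => /negP; apply.
  exact: edge_parent.
(* Grouping by target node: [x] is the only node with no forward equation. *)
have XT y : y != x -> \sum_j X y j = adjoint (T y).
  by move=> yx; rewrite XE /T [in RHS](tangent_other C1_assign _ yx).
have Xx : \sum_j X x j = 0.
  by rewrite XE parent_vals_tangent_self /adjoint !linear0.
move: sumE; rewrite (bigD1 x)//= [in RHS](bigD1 x)//= Xx add0r.
rewrite (eq_bigr _ XT) => /addIr.
by rewrite /T tangent_self.
Qed.

(** * Scores and total derivatives *)

Lemma score_total_derivative (x : node G) :
  [/\ differentiable (@ln R \o b x) (w x),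
      differentiable (output_of inp (x := x)) (w x)
    & score b w x =
      (derive1 phi zstar / phi zstar) *: total_derivative inp x].
Proof.
have [_ db] := belief_log_differentiable x.
have dz := is_diff_output_of C1_assign x.
have dzx : differentiable (output_of inp (x := x)) (w x) by exact: ex_diff.
split=> //; apply/rowP => i.
rewrite !mxE !deriveE// -/(adjoint _) adjoint_tangent adjoint_output.
by rewrite (@diff_val _ _ _ _ _ _ _ dz).
Qed.

Lemma score_output :
  output_val (score b w (output G)) = derive1 phi zstar / phi zstar.
Proof.
have [_ db] := belief_log_differentiable (output G).
rewrite /output_val mxE deriveE// -/(adjoint _) adjoint_output /output_val.
by rewrite mxE !eqxx mulr1.
Qed.

End Downward.
End Dag.

Theorem theorem3p3 (R : realType) (G : computation_dag R) (inp : valuation G)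
    (C1_assign : C1_assignments inp) :
  (forall phi : R -> R, C1 phi -> (forall t, 0 < phi t) ->
    forall (msg : node G -> node_functions G) (b : node_functions G),
    downward_pass phi (forward inp) msg b ->
    let zstar := output_val (forward inp (output G)) in
    output_val (score b (forward inp) (output G)) = derive1 phi zstar / phi zstar /\
    forall x : node G,
      [/\ differentiable (@ln R \o b x) (forward inp x),
          differentiable (output_of inp (x := x)) (forward inp x)
        & score b (forward inp) x =
          (derive1 phi zstar / phi zstar) *: total_derivative inp x]) /\
  (forall (alpha : R) (msg : node G -> node_functions G) (b : node_functions G),
    downward_pass (fun t => expR (alpha * t)) (forward inp) msg b ->
    forall x : node G,
      [/\ differentiable (@ln R \o b x) (forward inp x),
          differentiable (output_of inp (x := x)) (forward inp x)
        & score b (forward inp) x = alpha *: total_derivative inp x]).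
Proof.
split=> [phi C1_phi phi_gt0 msg b dp zstar|alpha msg b dp x].
  split; first exact: (score_output C1_assign C1_phi phi_gt0 dp).
  exact: (score_total_derivative C1_assign C1_phi phi_gt0 dp).
set phi := fun t => expR (alpha * t).
have dphi (t : R) : is_derive t 1 phi (alpha * phi t).
  have dmul : is_derive t 1 ( *%R alpha) alpha.
    rewrite -[X in is_derive _ _ _ X]mulr1.
    exact: (is_deriveZ alpha (is_derive_id t 1)).
  rewrite mulrC; exact: (is_derive1_comp (is_derive_expR (alpha * t)) dmul).
have phi'E : derive1 phi = fun t => alpha * phi t.
  by apply/funext => t; rewrite derive1E derive_val.
have C1_phi : C1 phi.
  split=> [t|]; first exact: ex_derive.
  rewrite phi'E => t; apply: differentiable_continuous; apply/derivable1_diffP.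
  by apply: derivableM => //; exact: ex_derive.
have phi_gt0 t : 0 < phi t by exact: expR_gt0.
have := score_total_derivative C1_assign C1_phi phi_gt0 dp x.
by rewrite phi'E mulfK// gt_eqF.
Qed.
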